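(* Let $V\in C^2(\mathbb{T}^d)$, let $u:\mathbb{T}^d\to\mathbb{R}$ be a semiconcave viscosity solution of $\frac12|Du(x)|^2+V(x)=0$ on $\mathbb{T}^d$, and let $x\in\mathbb{T}^d$ be such that $\sigma_u(x)<\infty$. Then: (a) $\mathbf{x}_u(\sigma_u(x),x)\in\mathrm{Crit}(u)$; (b) $V\big(\mathbf{x}_u(\sigma_u(x),x)\big)=0$ if and only if $\mathbf{x}_u(\sigma_u(x),x)\in\mathrm{Crit}^*(u)$; (c) $V\big(\mathbf{x}_u(\sigma_u(x),x)\big)<0$ if and only if $\mathbf{x}_u(\sigma_u(x),x)\in\mathrm{Sing}(u)$.
   Context: $\mathbb{T}^d=\mathbb{R}^d/\mathbb{Z}^d$ is the flat torus; functions on $\mathbb{T}^d$ are identified with their $\mathbb{Z}^d$-periodic extensions to $\mathbb{R}^d$. A continuous $u:\mathbb{T}^d\to\mathbb{R}$ is semiconcave if there is $C>0$ with $\lambda u(x)+(1-\lambda)u(y)-u(\lambda x+(1-\lambda)y)\le \frac C2\lambda(1-\lambda)|x-y|^2$ for all $x,y$ and $\lambda\in[0,1]$. The superdifferential is $D^+u(x)=\{p\in\mathbb{R}^d:\limsup_{y\to x}\frac{u(y)-u(x)-\langle p,y-x\rangle}{|y-x|}\le0\}$ and the subdifferential is $D^-u(x)=\{p\in\mathbb{R}^d:\liminf_{y\to x}\frac{u(y)-u(x)-\langle p,y-x\rangle}{|y-x|}\ge0\}$. $u$ is a viscosity solution of $\frac12|Du|^2+V=0$ if $\frac12|p|^2+V(x)\le0$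 for all $x$ and $p\in D^+u(x)$, and $\frac12|p|^2+V(x)\ge0$ for all $x$ and $p\in D^-u(x)$. (The critical constant $\max V$ has been absorbed into the potential, so that $\max_{\mathbb{T}^d}V=0$.) $\mathrm{Sing}(u)$ is the set of points where $u$ is not differentiable, $\mathrm{Crit}(u)=\{x:0\in D^+u(x)\}$, and $\mathrm{Crit}^*(u)=\mathrm{Crit}(u)\setminus\mathrm{Sing}(u)$. The generalized gradient flow $\mathbf{x}_u(\cdot,x):[0,\infty)\to\mathbb{T}^d$ is the unique locally Lipschitz solution of $\dot{\mathbf{x}}(t)\in D^+u(\mathbf{x}(t))$ for a.e. $t\ge0$, $\mathbf{x}(0)=x$. The critical time is $\sigma_u(x)=\inf\{t\ge0:\mathbf{x}_u(t,x)\in\mathrm{Crit}(u)\}\in[0,\infty]$ (with $\inf\varnothing=\infty$). *)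

(* Defs.v *)
(* A function on the flat torus T^d = R^d/Z^d is represented by its periodic
   extension to R^d, and a curve in T^d by its lift to R^d (locally Lipschitz
   curves lift uniquely once the starting point is lifted, and the lift has
   the same velocity).  The topology of 'rV[R]_d, and hence [continuous],
   [differentiable] and [lipschitz], come from the library's sup norm, which is
   equivalent to the Euclidean norm; the norm appearing in formulas is the
   Euclidean one, [enorm]. *)
From HB Require Import structures.
From mathcomp Require Export all_boot all_order all_algebra.
From mathcomp Require Export all_classical all_reals all_analysis.
Set Implicit Arguments.
Unset Strict Implicit.
Unset Printing Implicit Defensive.
Export Order.TTheory GRing.Theory Num.Theory.
Export numFieldNormedType.Exports.
Local Open Scope classical_set_scope.
Local Open Scope ring_scope.

Section Defs.
Context {R : realType} {d : nat}.
Implicit Types (f u V : 'rV[R]_d -> R) (x p : 'rV[R]_d) (g : R -> 'rV[R]_d).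

Definition dot x p : R := \sum_i x 0 i * p 0 i.

Definition enorm x : R := Num.sqrt (dot x x).

Definition periodic f :=
  forall x (k : 'rV[int]_d), f (x + map_mx intr k) = f x.

(* All partial derivatives of order at most n exist and are continuous. *)
Fixpoint class_C (n : nat) f : Prop :=
  continuous f /\
  match n with
  | 0%N => True
  | n'.+1 => forall i : 'I_d, (forall x, derivable f x (delta_mx 0 i)) /\
               class_C n' ('D_(delta_mx 0 i) f)
  end.

Definition semiconcave u :=
  continuous u /\
  exists2 C : R, 0 < C & forall x y (l : R), 0 <= l <= 1 ->
    l * u x + (1 - l) * u y - u (l *: x + (1 - l) *: y)
      <= C / 2 * l * (1 - l) * enorm (x - y) ^+ 2.

Definition diff_quotient u x p (y : 'rV[R]_d) : \bar R :=
  ((u y - u x - dot p (y - x)) / enorm (y - x))%:E.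

Definition superdiff u x : set 'rV[R]_d :=
  [set p | (limf_esup (diff_quotient u x p) x^' <= 0)%E].

Definition subdiff u x : set 'rV[R]_d :=
  [set p | (0 <= limf_einf (diff_quotient u x p) x^')%E].

Definition viscosity_solution V u :=
  (forall x p, superdiff u x p -> 2^-1 * enorm p ^+ 2 + V x <= 0) /\
  (forall x p, subdiff u x p -> 0 <= 2^-1 * enorm p ^+ 2 + V x).

Definition Sing u : set 'rV[R]_d := [set x | ~ differentiable u x].

Definition Crit u : set 'rV[R]_d := [set x | superdiff u x 0].

Definition Crit_star u : set 'rV[R]_d := Crit u `\` Sing u.

Definition locally_lipschitz_on (A : set R) g :=
  forall t, A t -> exists2 N, nbhs t N & [lipschitz g s | s in A `&` N].

(* For semiconcave [u] there is exactly one such curve on [0, +oo[, written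
   t |-> x_u(t, x); the values of [g] at negative times are
   irrelevant, and t = 0 is a null set, so the use of a two-sided derivative
   is harmless. *)
Definition generalized_gradient_flow u x g :=
  [/\ locally_lipschitz_on `[0, +oo[ g,
      {ae @lebesgue_measure R, forall t : R, 0 <= t ->
         derivable g t 1 /\ superdiff u (g t) (derive1 g t)} &
      g 0 = x].

(* The infimum of the empty set is +oo. *)
Definition critical_time u g : \bar R :=
  ereal_inf [set t%:E | t in [set t : R | 0 <= t /\ Crit u (g t)]].

End Defs.

(* Main.v *)
From HB Require Import structures.
Require Import Defs.
From mathcomp Require Import ring lra.
Set Implicit Arguments.
Unset Strict Implicit.
Unset Printing Implicit Defensive.
Local Open Scope classical_set_scope.
Local Open Scope ring_scope.

(** The three claims follow from [Crit u z] and the equivalence of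
    [differentiable u z] with [V z = 0].

    Semiconcavity turns every superdifferential [p] of [u] at [y] into a global
    bound: [u] lies below the paraboloid
    [u y + dot p (w - y) + C * |w - y|^2] ([semiconcave_paraboloid]).  So
    [Crit u] is an intersection of closed sets ([closed_Crit]), and since the
    flow is continuous for nonnegative times, the infimum defining the critical
    time is attained at a critical point [z] ([lipschitz_inf_closed]).

    If [u] is differentiable at [z], its only superdifferential there, namely
    [0], is also a subdifferential ([differentiable_superdiff_subdiff]); the
    supersolution inequality gives [V z >= 0], hence [V z = 0].

    Conversely let [V z = 0].  Near [z] the subsolution inequality
    [|p|^2 <= - 2 V y] makes all superdifferentials small.  The paraboloid at
    [y], evaluated at [z], then reads [u z <= u y + o(|y - z|)], so that [0] is
    a subdifferential at [z] ([viscosity_subdiff0]), and [u] is differentiable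
    because [0] is a superdifferential too ([differentiable_semidiff]).  This
    argument uses a superdifferential at [y], but by continuity it suffices to
    have one at points [y'] arbitrarily close to [y]: maximising
    [u - K |. - y|^2] over a small ball provides them ([superdiff_dense]). *)

(** * Comparison of the Euclidean and sup norms *)

Section EuclideanNorm.
Context {R : realType} {d : nat}.
Implicit Types (x y p q : 'rV[R]_d).

Lemma dotC x p : dot x p = dot p x.
Proof. by apply: eq_bigr => i _; rewrite mulrC. Qed.

Lemma dotDl x y p : dot (x + y) p = dot x p + dot y p.
Proof. by rewrite -big_split; apply: eq_bigr => i _; rewrite mxE mulrDl. Qed.

Lemma dotZl (a : R) x p : dot (a *: x) p = a * dot x p.
Proof. by rewrite mulr_sumr; apply: eq_bigr => i _; rewrite mxE mulrA. Qed.

Lemma dotDr x p q : dot x (p + q) = dot x p + dot x q.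
Proof. by rewrite dotC dotDl !(dotC _ x). Qed.

Lemma dotZr (a : R) x p : dot x (a *: p) = a * dot x p.
Proof. by rewrite dotC dotZl dotC. Qed.

Lemma dotNl x p : dot (- x) p = - dot x p.
Proof. by rewrite -scaleN1r dotZl mulN1r. Qed.

Lemma dotNr x p : dot x (- p) = - dot x p.
Proof. by rewrite dotC dotNl dotC. Qed.

Lemma dot0l p : dot 0 p = 0.
Proof. by rewrite -[0](scale0r (0 : 'rV_d)) dotZl mul0r. Qed.

Lemma dot_subC x y : dot (x - y) (x - y) = dot (y - x) (y - x).
Proof. by rewrite -opprB dotNl dotNr opprK. Qed.

Lemma dot_ge0 x : 0 <= dot x x.
Proof. by apply: sumr_ge0 => i _; rewrite -expr2 sqr_ge0. Qed.

Lemma enorm_sqr x : enorm x ^+ 2 = dot x x.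
Proof. by rewrite sqr_sqrtr ?dot_ge0. Qed.

Lemma coord_le_norm x i : `|x 0 i| <= `|x|.
Proof.
by rewrite [leRHS]mx_normrE (le_bigmax _ (fun ij => `|x ij.1 ij.2|) (0, i)).
Qed.

Lemma norm_dot_le x p : `|dot x p| <= d%:R * (`|x| * `|p|).
Proof.
apply: le_trans (ler_norm_sum _ _ _) _.
rewrite mulr_natl -[X in _ *+ X]card_ord -sumr_const; apply: ler_sum => i _.
by rewrite normrM ler_pM// coord_le_norm.
Qed.

Lemma norm_le_enorm x : `|x| <= enorm x.
Proof.
rewrite [leLHS]mx_normrE; apply: bigmax_le => [|[i j] _].
  exact: sqrtr_ge0.
rewrite -(ler_pXn2r (n := 2)) ?nnegrE ?sqrtr_ge0//= enorm_sqr.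
rewrite real_normK ?num_real//.
rewrite ord1 /dot (bigD1 j)//= expr2 lerDl.
by apply: sumr_ge0 => k _; rewrite -expr2 sqr_ge0.
Qed.

Lemma enorm_le_norm x : enorm x <= d%:R * `|x|.
Proof.
rewrite -(ler_pXn2r (n := 2)) ?nnegrE ?sqrtr_ge0 ?mulr_ge0//= enorm_sqr.
apply: le_trans (ler_norm _) _; apply: le_trans (norm_dot_le _ _) _.
rewrite -expr2 exprMn ler_wpM2r ?sqr_ge0// -natrX ler_nat.
by case: (d) => // n; rewrite leq_pmulr.
Qed.

Lemma dot_sub_littleo y (K e : R) : 0 < e ->
  \forall w \near y, K * dot (w - y) (w - y) <= e * `|w - y|.
Proof.
move=> e0; pose M := (`|K| + 1) * (d%:R + 1).
have M0 : 0 < M by rewrite mulr_gt0// ltr_wpDl.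
near=> w.
have wy : `|w - y| <= e / M.
  rewrite distrC; near: w; apply: cvgr_dist_le; first exact: cvg_id.
  exact: divr_gt0.
apply: le_trans (ler_norm _) _; rewrite normrM.
apply: (@le_trans _ _ (M * (`|w - y| * `|w - y|))).
  rewrite /M -mulrA ler_pM//; first by rewrite lerDl.
  by apply: le_trans (norm_dot_le _ _) _; rewrite ler_wpM2r ?mulr_ge0// lerDl.
by rewrite mulrA ler_wpM2r// -ler_pdivlMl// mulrC.
Unshelve. all: by end_near. Qed.

End EuclideanNorm.

(** * Semidifferentials of semiconcave functions *)

Lemma limf_esup_le0P {R : realType} {T : choiceType} {X : filteredType T}
  (F : set_system X) {FF : Filter F} (h : X -> R) :
  (limf_esup (EFin \o h) F <= 0)%E <->
  forall e, 0 < e -> \forall y \near F, h y <= e.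
Proof.
rewrite limf_esupE; split=> [h0 e e0|he].
  have /ereal_inf_lt[_ [A FA <-] Ae] :
      (ereal_inf [set ereal_sup ((EFin \o h) @` A) | A in F] < e%:E)%E.
    by apply: le_lt_trans h0 _; rewrite lte_fin.
  apply: filterS FA => y Ay; rewrite -lee_fin; apply: le_trans (ltW Ae).
  by apply: ereal_sup_ubound; exists y.
apply/lee_addgt0Pr => e e0; rewrite add0e; apply: ge_ereal_inf.
exists (ereal_sup ((EFin \o h) @` [set y | h y <= e])).
  by exists [set y | h y <= e] => //; exact: he.
by apply: ge_ereal_sup => _ [y /= ye <-]; rewrite lee_fin.
Qed.

Section Semidifferentials.
Context {R : realType} {d : nat}.
(* The topology of ['rV[R]_d] can be inferred from the topology of its
   coefficients or from its norm; [E] selects the latter, to which the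
   continuity lemmas for normed modules apply.  For the same reason the local
   continuity facts below are first proved over an abstract normed module [T],
   whose topology has a single presentation. *)
Local Notation E := ('rV[R]_d : normedModType R).
Implicit Types (u V : 'rV[R]_d -> R) (x y z p : 'rV[R]_d).

(** As the norms are equivalent, the Euclidean norm in the difference quotient
    can be traded for the sup norm that governs the topology; multiplying out
    also removes the puncture at [x], where both sides vanish. *)
Lemma superdiffP u x p : superdiff u x p <->
  forall e, 0 < e ->
    \forall y \near x, u y - u x - dot p (y - x) <= e * `|y - x|.
Proof.
have d1_gt0 : 0 < d%:R + 1 :> R by rewrite ltr_wpDl.
rewrite /superdiff/=.
have -> : diff_quotient u x p =
  EFin \o (fun y => (u y - u x - dot p (y - x)) / enorm (y - x)) by [].
rewrite limf_esup_le0P; split=> he e e0.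
  have := he (e / (d%:R + 1)) (divr_gt0 e0 d1_gt0).
  rewrite near_withinE; apply: filterS => y yx.
  have [->|y_neq_x] := eqVneq y x.
    by rewrite !subrr dotC dot0l subr0 normr0 mulr0.
  have xy0 : 0 < enorm (y - x).
    by apply: lt_le_trans (norm_le_enorm _); rewrite normr_gt0 subr_eq0.
  move: (yx y_neq_x); rewrite ler_pdivrMr// => /le_trans; apply.
  rewrite -mulrA ler_pM2l// ler_pdivrMl//.
  apply: le_trans (enorm_le_norm _) _.
  by rewrite ler_wpM2r// lerDl.
rewrite near_withinE; apply: filterS (he e e0) => y yx y_neq_x.
have xy0 : 0 < enorm (y - x).
  by apply: lt_le_trans (norm_le_enorm _); rewrite normr_gt0 subr_eq0.
rewrite ler_pdivrMr//; apply: le_trans yx _.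
by rewrite ler_pM2l// norm_le_enorm.
Qed.

Lemma subdiffN u x p : subdiff u x p <-> superdiff (\- u) x (- p).
Proof.
rewrite /subdiff /superdiff/= /limf_einf oppe_ge0.
have -> // : (\- diff_quotient u x p)%E = diff_quotient (\- u) x (- p).
apply/funext => y; rewrite /diff_quotient -EFinN dotNl -mulNr.
by rewrite /=; congr (_ / _)%:E; ring.
Qed.

(** The quadratic term is negligible against [|w - y|], so a paraboloid
    touching [u] from above at [y], even one that opens upwards, yields its
    slope as a superdifferential. *)
Lemma superdiff_touch_above u y q (K : R) :
    (\forall w \near y, u w <= u y + dot q (w - y) + K * dot (w - y) (w - y)) ->
  superdiff u y q.
Proof.
move=> uK; apply/superdiffP => e e0; near=> w.
have : u w <= u y + dot q (w - y) + K * dot (w - y) (w - y) by near: w.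
have : K * dot (w - y) (w - y) <= e * `|w - y|.
  by near: w; exact: dot_sub_littleo.
lra.
Unshelve. all: by end_near. Qed.

(** Along the segment from [y] to [w], semiconcavity bounds [u w - u y] by the
    quotient [(u (y + l (w - y)) - u y) / l] plus a quadratic term; the
    superdifferential controls that quotient as [l] tends to [0]. *)
Lemma semiconcave_paraboloid u : semiconcave u ->
  exists C : R, forall y p, superdiff u y p -> forall w,
    u w <= u y + dot p (w - y) + C * dot (w - y) (w - y).
Proof.
move=> [_ [C C0 uC]]; exists (C / 2).
move=> y p /superdiffP up w; apply/ler_addgt0Pr => e e0.
set v := w - y.
have e'0 : 0 < e / (`|v| + 1) by rewrite divr_gt0// ltr_wpDl.
have /nbhs_ballP[r /= r0 rP] := up _ e'0.
(* Short enough for [y + l *: v] to stay in the ball of radius [r], and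
   small enough to be a convex weight. *)
pose l := Num.min 1 (r / 2 / (`|v| + 1)).
have l0 : 0 < l by rewrite lt_min ltr01/= !divr_gt0// ltr_wpDl.
have l1 : l <= 1 by rewrite ge_min lexx.
have lv : `|l *: v| < r.
  rewrite normrZ (gtr0_norm l0).
  apply: (@le_lt_trans _ _ (r / 2)); last lra.
  have : l <= r / 2 / (`|v| + 1) by rewrite ge_min lexx orbT.
  rewrite ler_pdivlMr ?ltr_wpDl//; apply: le_trans.
  by rewrite ler_pM2l// lerDl.
have l01 : 0 <= l <= 1 by rewrite ltW.
have yl : l *: w + (1 - l) *: y = y + l *: v.
  by rewrite scalerBl scale1r scalerBr addrCA.
have := uC w y l l01; rewrite yl enorm_sqr -/v.
have := rP (y + l *: v).
rewrite -ball_normE /ball_/= opprD addNKr normrN => /(_ lv).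
rewrite [y + _]addrC addrK dotZr normrZ (gtr0_norm l0).
set D := dot v v; set P := dot p v; set U := u _.
have D0 : 0 <= D := dot_ge0 v.
have ev : e / (`|v| + 1) * (l * `|v|) <= l * e.
  rewrite mulrCA ler_pM2l// -mulrA ler_piMr ?(ltW e0)// mulrC.
  rewrite ler_pdivrMr ?ltr_wpDl//.
  by rewrite mul1r lerDl.
move=> h1 h2; rewrite -(ler_pM2l l0).
have : 0 <= C * l * l * D by rewrite !mulr_ge0// ltW.
nra.
Qed.

Lemma continuous_dot_sub y :
  continuous (fun w : E => dot (w - y) (w - y)).
Proof.
have coordB i : continuous (fun w : E => (w - y) 0 i : R).
  rewrite (_ : (fun w => _) = fun w : E => w 0 i - y 0 i); last first.
    by apply/funext => w; rewrite !mxE.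
  have cB (T : normedModType R) (f : T -> R) b :
      continuous f -> continuous (fun w => f w - b).
    by move=> fC w; apply: cvgB; [exact: fC|exact: cvg_cst].
  by apply: cB => w; exact: (@coord_continuous R 1 d 0 i w).
have sumM (T : normedModType R) (f : 'I_d -> T -> R) :
    (forall i, continuous (f i)) -> continuous (fun w => \sum_i f i w * f i w).
  move=> fC; apply: (continuous_big add_continuous) => i _ w.
  by apply: cvgM; exact: fC.
exact: (sumM _ (fun i w => (w - y) 0 i) coordB).
Qed.

Lemma continuous_addZ_dot_sub u (K : R) y : continuous u ->
  continuous (fun w : E => u w + K * dot (w - y) (w - y)).
Proof.
have cDZ (T : normedModType R) (f g : T -> R) :
    continuous f -> continuous g -> continuous (fun w => f w + K * g w).
  move=> fC gC w; apply: cvgD; first exact: fC.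
  by apply: cvgM; [exact: cvg_cst|exact: gC].
by move=> uC; apply: cDZ => //; exact: continuous_dot_sub.
Qed.

(** At a maximum point [m] of [u - K |. - y|^2] over the closed ball of radius
    [r], the slope [2 K (m - y)] is a superdifferential, provided that [m] is
    interior.  A large [K] ensures this: on the boundary the penalty exceeds the
    oscillation of [u], which makes the value there smaller than at [y]. *)
Lemma superdiff_dense u : continuous u -> forall y (r : R), 0 < r ->
  exists2 y', `|y' - y| < r & exists p, superdiff u y' p.
Proof.
move=> uC y r r0.
pose B := closed_ball_ Num.norm y r.
have cB : compact B.
  apply: bounded_closed_compact; last exact: closed_closed_ball_.
  exists (`|y| + r); split; first exact: num_real.
  move=> M yrM w; rewrite /B /closed_ball_/= => yw; apply: le_trans (ltW yrM).
  by rewrite -[w](subrK y) addrC (le_trans (ler_normD _ _))// lerD2l distrC.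
have B0 : B !=set0 by exists y; rewrite /B /closed_ball_/= subrr normr0 ltW.
have yB : y \in B by rewrite inE /B /closed_ball_/= subrr normr0 ltW.
have [xM _ xMP] := EVT_max_rV B0 cB (continuous_subspaceT uC).
(* With this [K] the penalty on the boundary is at least
   [max u - u y + 1], where the maximum is taken over the ball. *)
pose K := (u xM - u y + 1) / r ^+ 2.
have K0 : 0 <= K.
  by rewrite divr_ge0 ?sqr_ge0// addr_ge0// subr_ge0 xMP.
pose f w := u w + - K * dot (w - y) (w - y).
have fC : continuous f.
  exact: continuous_addZ_dot_sub.
have [m mB mP] := EVT_max_rV B0 cB (continuous_subspaceT fC).
have ym : `|m - y| < r.
  rewrite ltNge; apply/negP => rm.
  have := mP _ yB; rewrite /f subrr dot0l mulr0 addr0 leNgt => /negP; apply.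
  have : K * r ^+ 2 <= K * dot (m - y) (m - y).
    rewrite ler_wpM2l// -enorm_sqr ler_pXn2r ?nnegrE ?sqrtr_ge0 ?(ltW r0)//.
    exact: le_trans rm (norm_le_enorm _).
  rewrite /K divfK ?expf_neq0 ?gt_eqF//.
  have := xMP _ mB; lra.
exists m => //; exists (2 * K *: (m - y)).
apply: (@superdiff_touch_above _ _ _ K).
have rm : 0 < r - `|m - y| by rewrite subr_gt0.
near=> w.
have wB : w \in B.
  rewrite inE /B /closed_ball_/= distrC -[w](subrK m) -addrA.
  apply: le_trans (ler_normD _ _) _; rewrite -lerBrDr distrC.
  near: w; apply: cvgr_dist_le => //; exact: cvg_id.
have := mP _ wB; rewrite /f.
have -> : w - y = (w - m) + (m - y) by rewrite addrA subrK.
move: (w - m) (m - y) => a b.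
rewrite !dotDl !dotDr dotZl (dotC a b); lra.
Unshelve. all: by end_near. Qed.

(** If [y] has a superdifferential [p] with [|p| <= e], the bound is the
    paraboloid at [y] evaluated at [z].  Both sides are continuous in [y], so it
    extends from the dense set of such points to the whole ball. *)
Lemma superdiff_small_lower u (C e r : R) z :
    continuous u ->
    (forall y p, superdiff u y p -> forall w,
       u w <= u y + dot p (w - y) + C * dot (w - y) (w - y)) ->
    (forall y p, `|y - z| < r -> superdiff u y p -> `|p| <= e) ->
  forall y, `|y - z| < r ->
    u z - u y <= d%:R * e * `|y - z| + C * dot (y - z) (y - z).
Proof.
move=> uC upar psmall y yr; rewrite leNgt; apply/negP => Fy.
pose F w := u w + d%:R * e * `|w - z| + C * dot (w - z) (w - z).
have Fc : continuous (F : E -> R).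
  apply: continuous_addZ_dot_sub.
  have uDn (T : normedModType R) (f : T -> R) c b :
      continuous f -> continuous (fun w => f w + c * `|w - b|).
    move=> fC w; apply: cvgD; first exact: fC.
    apply: cvgM; first exact: cvg_cst.
    exact: (cvg_norm (cvgB (@cvg_id T (nbhs w)) (cvg_cst b))).
  exact: uDn.
have Fyz : F y < u z by rewrite /F; lra.
have : \forall w \near y, F w < u z by exact: (Fc y _ (lt_nbhsl Fyz)).
have : \forall w \near y, `|w - z| < r.
  have yzr : 0 < r - `|y - z| by rewrite subr_gt0.
  near=> w; rewrite -[w](subrK y) -addrA.
  apply: le_lt_trans (ler_normD _ _) _; rewrite -ltrBrDr distrC.
  near: w; apply: cvgr_dist_lt => //; exact: cvg_id.
move=> zr Fu; have /nbhs_ballP[s /= s0 sP] :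
    \forall w \near (y : E), `|w - z| < r /\ F w < u z.
  exact: filterI zr Fu.
have [w wy [p pw]] := superdiff_dense uC y s0.
have [wz Fw] : `|w - z| < r /\ F w < u z.
  by apply: sP; rewrite -ball_normE/= distrC.
have := upar _ _ pw z; move: Fw; rewrite /F.
rewrite (dot_subC z).
have : dot p (z - w) <= d%:R * e * `|w - z|.
  apply: le_trans (ler_norm _) _; apply: le_trans (norm_dot_le _ _) _.
  by rewrite -mulrA ler_wpM2l// distrC ler_wpM2r//; exact: psmall pw.
lra.
Unshelve. all: by end_near. Qed.

(** Where [V] vanishes, the subsolution inequality [|p|^2 <= - 2 V] forces the
    superdifferentials at nearby points to be small. *)
Lemma viscosity_subdiff0 V u z :
    continuous V -> semiconcave u -> viscosity_solution V u -> V z = 0 ->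
  subdiff u z 0.
Proof.
move=> Vc u_sc [u_sub _] Vz0; have uC := u_sc.1.
have [C upar] := semiconcave_paraboloid u_sc.
apply/subdiffN/superdiffP => e e0; rewrite oppr0.
(* [superdiff_small_lower] loses a factor [d]; half of [e] is kept for the
   quadratic term. *)
pose e' := e / 2 / (d%:R + 1).
have d1_gt0 : 0 < d%:R + 1 :> R by rewrite ltr_wpDl.
have e'0 : 0 < e' by rewrite !divr_gt0.
have [r /= r0 rV] : exists2 r, 0 < r &
    forall y, `|y - z| < r -> - (e' ^+ 2 / 2) < V y.
  have Vze : - (e' ^+ 2 / 2) < V z by rewrite Vz0 oppr_lt0 divr_gt0// exprn_gt0.
  have /nbhs_ballP[r /= r0 rP] := Vc z _ (lt_nbhsr Vze).
  by exists r => // y yr; apply: rP; rewrite -ball_normE/= distrC.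
have psmall y p : `|y - z| < r -> superdiff u y p -> `|p| <= e'.
  move=> yr pu; apply: le_trans (norm_le_enorm _) _.
  rewrite -(ler_pXn2r (n := 2)) ?nnegrE ?sqrtr_ge0 ?(ltW e'0)//.
  have := u_sub _ _ pu; have := rV _ yr; lra.
near=> y; rewrite dot0l subr0 opprK addrC.
have yr : `|y - z| < r.
  rewrite distrC; near: y; apply: cvgr_dist_lt => //; exact: cvg_id.
apply: le_trans (superdiff_small_lower uC upar psmall yr) _.
rewrite [e in leRHS]splitr mulrDl lerD//.
  rewrite ler_wpM2r// /e' mulrCA ler_piMr ?divr_ge0 ?(ltW e0)//.
  by rewrite ler_pdivrMr// mul1r lerDl.
by near: y; apply: dot_sub_littleo; rewrite divr_gt0.
Unshelve. all: by end_near. Qed.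

Lemma dot_is_linear p : linear (dot p : 'rV[R]_d -> R).
Proof. by move=> a v w; rewrite dotDr dotZr. Qed.

HB.instance Definition _ p :=
  GRing.isLinear.Build R _ R _ (dot p) (dot_is_linear p).

Lemma dot_continuous p : continuous (dot p : E -> R).
Proof.
have sumZ (T : normedModType R) (f : 'I_d -> T -> R) :
    (forall i, continuous (f i)) -> continuous (fun w => \sum_i p 0 i * f i w).
  move=> fC; apply: (continuous_big add_continuous) => i _ w.
  by apply: cvgM; [exact: cvg_cst|exact: fC].
apply: (sumZ E (fun i w => w 0 i)) => i w.
exact: (@coord_continuous R 1 d 0 i w).
Qed.

(** The two one-sided first-order expansions with the same slope combine into
    [u y = u z + dot p (y - z) + o(|y - z|)]. *)
Lemma differentiable_semidiff u z p :
  superdiff u z p -> subdiff u z p -> differentiable u z.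
Proof.
move=> /superdiffP up /subdiffN/superdiffP down; apply/diffP.
(* The differential is defined by choice, so it suffices to exhibit a
   continuous linear map with the right expansion. *)
apply: (@getPex _ (fun df : {linear 'rV[R]_d -> R} => continuous df /\
  forall x, u x = u (lim (nbhs z)) + df (x - lim (nbhs z))
    +o_(x \near nbhs z) (x - lim (nbhs z)))).
exists (dot p : {linear 'rV[R]_d -> R}); split; first exact: dot_continuous.
rewrite lim_id//.
suff : u = (fun y => u z + dot p (y - z)) +o_ (nbhs z) (center z).
  by rewrite funeqE.
apply/eqaddoP => e e0.
near=> y.
have : u y - u z - dot p (y - z) <= e * `|y - z| by near: y; exact: up.
have : - u y - - u z - dot (- p) (y - z) <= e * `|y - z|.
  by near: y; exact: down.
rewrite dotNl /= ler_norml => h1 h2; apply/andP; split; rewrite ?fctE/=; lra.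
Unshelve. all: by end_near. Qed.

(** The superdifferential inequality bounds ['d u z - dot p] from above by
    [o(|y - z|)]; this map is odd, so reflecting [y] through [z] bounds it from
    below as well, and the two slopes agree to first order. *)
Lemma differentiable_superdiff_subdiff u z p :
  differentiable u z -> superdiff u z p -> subdiff u z p.
Proof.
move=> uz /superdiffP up; apply/subdiffN/superdiffP.
have : u = (fun y => u z + 'd u z (y - z)) +o_ (nbhs z) (center z).
  by have /diffP[_] := uz; rewrite lim_id// funeqE.
move=> /eqaddoP ud.
have near0 e : 0 < e ->
    \forall y \near z, `|'d u z (y - z) - dot p (y - z)| <= e * `|y - z|.
  move=> e0.
  have : \forall y \near (z : E),
      'd u z (y - z) - dot p (y - z) <= e * `|y - z|.
    near=> y.
    have : u y - u z - dot p (y - z) <= e / 2 * `|y - z|.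
      by near: y; apply: up; rewrite divr_gt0.
    have : `|u y - (u z + 'd u z (y - z))| <= e / 2 * `|y - z|.
      by near: y; apply: ud; rewrite divr_gt0.
    rewrite ler_norml => /andP[h1 h2]; lra.
  move=> /nbhs_ballP[r /= r0 rP]; apply/nbhs_ballP; exists r => //= y zy.
  have := rP _ zy.
  have : ball z r (z - (y - z)).
    by move: zy; rewrite -ball_normE/= opprD addNKr opprK distrC.
  move/rP; rewrite addrAC subrr add0r normrN linearN/= dotNr.
  rewrite ler_norml => h1 h2; apply/andP; split; lra.
move=> e e0; near=> y.
have : `|'d u z (y - z) - dot p (y - z)| <= e / 2 * `|y - z|.
  by near: y; apply: near0; rewrite divr_gt0.
have : `|u y - (u z + 'd u z (y - z))| <= e / 2 * `|y - z|.
  by near: y; apply: ud; rewrite divr_gt0.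
rewrite dotNl !ler_norml => /andP[h1 h2] /andP[h3 h4]; rewrite /=.
lra.
Unshelve. all: by end_near. Qed.

(** By [semiconcave_paraboloid] and its converse [superdiff_touch_above],
    [y] is critical iff [u w <= u y + C * |w - y|^2] for every [w], and each of
    these conditions is closed in [y]. *)
Lemma closed_Crit u : semiconcave u -> closed (Crit u).
Proof.
move=> u_sc; have uC := u_sc.1.
have [C upar] := semiconcave_paraboloid u_sc.
rewrite (_ : Crit u = \bigcap_(w in [set: 'rV[R]_d])
  [set y | u w <= u y + C * dot (y - w) (y - w)]).
  apply: closed_bigI => w _.
  have /continuous_closedP :
      continuous (fun y : E => u y + C * dot (y - w) (y - w)).
    exact: continuous_addZ_dot_sub.
  by move/(_ _ (@closed_ge R (u w))).
apply/seteqP; split=> [y yu w _|y yu].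
  by have := upar _ _ yu w; rewrite dot0l addr0 (dot_subC w).
apply: (@superdiff_touch_above _ _ _ C); near=> w.
by rewrite dot0l addr0 (dot_subC w); exact: yu.
Unshelve. all: by end_near. Qed.

End Semidifferentials.

(** * Hitting times of closed sets *)

(** Times in the set come arbitrarily close to its infimum, which is itself
    nonnegative; a Lipschitz bound near that time makes [g] at the infimum a
    limit of points of [A]. *)
Lemma lipschitz_inf_closed {R : realType} {d : nat} (g : R -> 'rV[R]_d)
    (A : set 'rV[R]_d) :
    locally_lipschitz_on `[0, +oo[ g -> closed A ->
    [set t | 0 <= t /\ A (g t)] !=set0 ->
  A (g (inf [set t | 0 <= t /\ A (g t)])).
Proof.
move=> gL Acl S0; set S := [set t | _]; set s := inf S.
have Slb : has_inf S by split=> //; exists 0 => t [].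
have s0 : 0 <= s by apply: lb_le_inf => // t [].
have [|N Ns gN] := gL s; first by rewrite /= in_itv/= s0.
have /nbhs_ballP[r /= r0 rN] := Ns.
apply: Acl => B /nbhs_ballP[e /= e0 eB].
near (pinfty_nbhs R) => k.
have k0 : 0 < k by near: k; exact: nbhs_pinfty_gt.
have gk : k.-lipschitz_(`[0, +oo[%classic `&` N) g by near: k; exact: gN.
have m0 : 0 < Num.min r (e / k) by rewrite lt_min r0 divr_gt0.
have [t [t0 At] ts] := inf_adherent m0 Slb.
have st : s <= t by apply: ge_inf => //; exact: Slb.2.
have : t - s < Num.min r (e / k) by rewrite ltrBlDl.
rewrite lt_min => /andP[tr te].
exists (g t); split=> //; apply: eB; rewrite -ball_normE/=.
have := gk (s, t); rewrite /= => /(_ _)/le_lt_trans; apply.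
  split; split; rewrite /= ?in_itv/= ?s0 ?t0//; first exact: nbhs_singleton.
  by apply: rN; rewrite /ball/= distrC ger0_norm ?subr_ge0.
by rewrite distrC ger0_norm ?subr_ge0// -ltr_pdivlMl// mulrC.
Unshelve. all: by end_near. Qed.

(** * The limit point at the critical time *)

Theorem proposition15 (R : realType) (d : nat)
  (V : 'rV[R]_d -> R) (V_per : periodic V) (V_C2 : class_C 2 V)
  (V_max : (forall y, V y <= 0) /\ (exists y, V y = 0))
  (u : 'rV[R]_d -> R) (u_per : periodic u) (u_sc : semiconcave u)
  (u_visc : viscosity_solution V u)
  (x : 'rV[R]_d) (xu : R -> 'rV[R]_d)
  (xu_flow : generalized_gradient_flow u x xu)
  (sigma_fin : (critical_time u xu < +oo)%E) :
  let z := xu (fine (critical_time u xu)) in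
  [/\ Crit u z,
      V z = 0 <-> Crit_star u z &
      V z < 0 <-> Sing u z].
Proof.
move=> z.
have S0 : [set t : R | 0 <= t /\ Crit u (xu t)] !=set0.
  have [_ [t tS _] _] := ereal_inf_lt sigma_fin.
  by exists t.
have Cz : Crit u z.
  rewrite /z /critical_time ereal_inf_EFin//; last by exists 0 => t [].
  apply: lipschitz_inf_closed => //; last exact: closed_Crit.
  by case: xu_flow.
have diffV : differentiable u z <-> V z = 0.
  split=> [uz|Vz0]; last first.
    apply: differentiable_semidiff Cz _.
    exact: viscosity_subdiff0 V_C2.1 u_sc u_visc Vz0.
  have := u_visc.2 _ _ (differentiable_superdiff_subdiff uz Cz).
  rewrite enorm_sqr dot0l mulr0 add0r => Vz.
  by apply/eqP; rewrite eq_le V_max.1.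
split=> //.
  by split=> [/diffV uz|[_ /contrapT/diffV//]]; split=> //; exact.
rewrite lt_neqAle V_max.1 andbT; split=> [/eqP Vz /diffV//|uz].
by apply/eqP => /diffV.
Qed.
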